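(* Suppose Assumptions 1-3 of the context hold and the sampling distributions are normal, the replications of design $h$ in context $\boldsymbol x_\ell$ being $N(y_h(\boldsymbol x_\ell),\sigma_h^2(\boldsymbol x_\ell))$ with $\sigma_h^2(\boldsymbol x_\ell)>0$. Then the asymptotically optimal sampling ratios $\boldsymbol r^*=(r^*_{h\ell})$, i.e. those which optimize the large deviations rate $\mathcal R(\boldsymbol r)$ of $\mathrm{PFS}_W$ over all $\boldsymbol r$ with $r_{h\ell}\ge0$ and $\sum_{h=1}^k\sum_{\ell=1}^q r_{h\ell}=1$, satisfy, for all $i,i'=1,\dots,m$, $j,j'=m+1,\dots,k$ and $\ell,\ell'=1,\dots,q$, with $$G_{ij}^\ell(\boldsymbol r)=\frac{\big(y_{\langle i\rangle_\ell}(\boldsymbol x_\ell)-y_{\langle j\rangle_\ell}(\boldsymbol x_\ell)\big)^2}{\sigma^2_{\langle i\rangle_\ell}(\boldsymbol x_\ell)/r_{\langle i\rangle\ell}+\sigma^2_{\langle j\rangle_\ell}(\boldsymbol x_\ell)/r_{\langle j\rangle\ell}},$$ the equalities $$\min_{j=m+1,\dots,k}G_{ij}^\ell(\boldsymbol r^* )=\min_{i'=1,\dots,m}G_{i'j'}^\ell(\boldsymbol r^* )=\min_{j=m+1,\dots,k}G_{ij}^{\ell'}(\boldsymbol r^* )=\min_{i'=1,\dots,m}G_{i'j'}^{\ell'}(\boldsymbol r^* )$$ (in the first and third terms $i$ is free and the minimum is over $j$; in the second and fourth $j'$ is free and the minimum is over $i'$), and $$\sum_{i=1}^m\frac{(r^*_{\langle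 i\rangle\ell})^2}{\sigma^2_{\langle i\rangle_\ell}(\boldsymbol x_\ell)}=\sum_{j=m+1}^k\frac{(r^*_{\langle j\rangle\ell})^2}{\sigma^2_{\langle j\rangle_\ell}(\boldsymbol x_\ell)},\qquad \ell=1,\dots,q.$$
   Context: Setting. There are $k$ designs, $q$ contexts $\boldsymbol x_1,\dots,\boldsymbol x_q$, and an integer $1\le m<k$. Replications of each design-context pair $(h,\ell)$ are i.i.d. with mean $y_h(\boldsymbol x_\ell)$, independent across pairs. For each $\ell$, designs are ranked by true means: $y_{\langle1\rangle_\ell}(\boldsymbol x_\ell)\ge\dots\ge y_{\langle m\rangle_\ell}(\boldsymbol x_\ell)>y_{\langle m+1\rangle_\ell}(\boldsymbol x_\ell)\ge\dots\ge y_{\langle k\rangle_\ell}(\boldsymbol x_\ell)$. A subscript $\langle h\rangle\ell$ refers to the pair (design $\langle h\rangle_\ell$, context $\ell$). The number $r_{h\ell}\ge0$ is the fraction of the total budget $T$ allocated to pair $(h,\ell)$, and $\bar Y_{h\ell}(r_{h\ell}T)$ is the sample mean of $r_{h\ell}T$ replications. Let $\Lambda_{h\ell}(\lambda)=\lim_{n\to\infty}\frac1n\log\mathbb E\exp(n\lambda\bar Y_{h\ell}(n))$ (for i.i.d. replications this is the log moment generating function of one replication), $\mathcal D_{h\ell}=\{\lambda\in\mathbb R:\Lambda_{h\ell}(\lambda)<\infty\}$, $\mathcal F_{h\ell}=\{\Lambda_{h\ell}'(\lambda):\lambda\in\mathcal D_{h\ell}^o\}$, with $^o$ denoting interior, and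 $\Lambda^*_{h\ell}(x)=\sup_{\lambda\in\mathbb R}\{\lambda x-\Lambda_{h\ell}(\lambda)\}$. Assumption 1: $\Lambda_{h\ell}(\lambda)$ is well defined as an extended real number for all $\lambda$, and $0\in\mathcal D_{h\ell}^o$, for all $h,\ell$. Assumption 2: $\Lambda_{h\ell}$ is strictly convex and continuous on $\mathcal D_{h\ell}^o$ and steep, i.e. $|\Lambda_{h\ell}'(\lambda_n)|\to\infty$ for any sequence $\lambda_n$ converging to a boundary point of $\mathcal D_{h\ell}^o$, for all $h,\ell$. Assumption 3: $[y_{\langle k\rangle_\ell}(\boldsymbol x_\ell),y_{\langle1\rangle_\ell}(\boldsymbol x_\ell)]\subset\bigcap_{i=1}^k\mathcal F_{i\ell}^o$ for all $\ell$. The worst-case probability of false selection is $\mathrm{PFS}_W=\max_{\ell}\Pr\{\bigcup_{i=1}^m\bigcup_{j=m+1}^k(\bar Y_{\langle i\rangle\ell}(r_{\langle i\rangle\ell}T)\le\bar Y_{\langle j\rangle\ell}(r_{\langle j\rangle\ell}T))\}$, and its large deviations rate is $$\mathcal R(\boldsymbol r)=-\lim_{T\to\infty}\tfrac1T\log\mathrm{PFS}_W=\min_{\ell=1,\dots,q}\ \min_{\substack{i=1,\dots,m\\ j=m+1,\dots,k}}\mathcal R_{ij}^\ell(r_{\langle i\rangle\ell},r_{\langle j\rangle\ell}),$$ where $\mathcal R_{ij}^\ell(a,b)=a\Lambda^*_{\langle i\rangle\ell}(x)+b\Lambda^*_{\langle j\rangle\ell}(x)$ for $a,b>0$, with $x=x(a,b)$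 the unique solution of $a\frac{d}{dx}\Lambda^*_{\langle i\rangle\ell}(x)+b\frac{d}{dx}\Lambda^*_{\langle j\rangle\ell}(x)=0$, and $\mathcal R_{ij}^\ell(a,b)=0$ if $a=0$ or $b=0$. In the normal case, for $a,b>0$, $\mathcal R_{ij}^\ell(a,b)=\frac{(y_{\langle i\rangle_\ell}(\boldsymbol x_\ell)-y_{\langle j\rangle_\ell}(\boldsymbol x_\ell))^2}{2(\sigma^2_{\langle i\rangle_\ell}(\boldsymbol x_\ell)/a+\sigma^2_{\langle j\rangle_\ell}(\boldsymbol x_\ell)/b)}$. *)

(* Defs.v *)
From HB Require Import structures.
From mathcomp Require Import all_boot all_order all_algebra all_fingroup.
From mathcomp Require Import all_classical all_reals all_analysis.

Set Implicit Arguments.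
Unset Strict Implicit.
Unset Printing Implicit Defensive.

Import Order.TTheory GRing.Theory Num.Theory.
Import numFieldNormedType.Exports.

Local Open Scope classical_set_scope.
Local Open Scope ring_scope.

Section OnePair.
Context (d : measure_display) (Omega : measurableType d) (R : realType)
  (P : probability Omega R) (X : nat -> Omega -> R).

Definition sample_mean (n : nat) (w : Omega) : R :=
  (\sum_(t < n) X t w) / n%:R.

Definition cgf_seq (lambda : R) (n : nat) : \bar R :=
  ((n%:R^-1)%:E *
   lne 'E_P[fun w => expR (n%:R * lambda * sample_mean n w)])%E.

(* Meaningful when [cgf_seq lambda] converges in [\bar R]. *)
Definition cgf (lambda : R) : \bar R := lim (cgf_seq lambda @ \oo).

Definition cgf_dom : set R := [set lambda | (cgf lambda < +oo)%E].

(* [cgf] read as a real function; used on the interior of [cgf_dom] only. *)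
Definition cgfr (lambda : R) : R := fine (cgf lambda).

Definition cgf_slopes : set R := [set derive1 cgfr lambda | lambda in cgf_dom°].

Definition cgf_well_defined : Prop :=
  (forall lambda : R, cvg (cgf_seq lambda @ \oo)) /\ (cgf_dom°) 0.

Definition cgf_strictly_convex : Prop :=
  forall a b t : R, (cgf_dom°) a -> (cgf_dom°) b -> a != b -> 0 < t < 1 ->
    cgfr (t * a + (1 - t) * b) < t * cgfr a + (1 - t) * cgfr b.

Definition cgf_continuous : Prop :=
  forall lambda : R, (cgf_dom°) lambda -> {for lambda, continuous cgfr}.

(* [cgf_dom°] being open, its boundary is [closure cgf_dom° `\` cgf_dom°]. *)
Definition cgf_steep : Prop :=
  forall (u : nat -> R) (b : R), (forall n, (cgf_dom°) (u n)) ->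
    (closure (cgf_dom°) `\` cgf_dom°) b -> u @ \oo --> b ->
    `|derive1 cgfr (u n)| @[n --> \oo] --> +oo.

End OnePair.

Definition mutually_independent (d : measure_display) (Omega : measurableType d)
    (R : realType) (P : probability Omega R) (I : eqType)
    (X : I -> Omega -> R) : Prop :=
  forall (s : seq I) (A : I -> set R), uniq s ->
    (forall i, measurable (A i)) ->
    P (\big[setI/setT]_(i <- s) (X i @^-1` A i))
    = (\prod_(i <- s) P (X i @^-1` A i))%E.

Section Selection.
Context (d : measure_display) (Omega : measurableType d) (R : realType)
  (P : probability Omega R) (k q m : nat).
(* [Y h l t] is the [t]-th replication of design [h] in context [l]. *)
Context (Y : 'I_k -> 'I_q -> nat -> Omega -> R).
Context (y : 'I_k -> 'I_q -> R).
(* [rk l i] is the design of rank [i] in context [l]; ranks start at 0, so that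
   the true top [m] designs are those of rank [i < m]. *)
Context (rk : 'I_q -> {perm 'I_k}).

Definition ranked_by_mean : Prop :=
  forall l : 'I_q,
    (forall i j : 'I_k, (i <= j)%N -> y (rk l j) l <= y (rk l i) l) /\
    (forall i j : 'I_k, i.+1 = m -> j = m :> nat -> y (rk l j) l < y (rk l i) l).

Definition assumption1 : Prop := forall h l, cgf_well_defined P (Y h l).

Definition assumption2 : Prop := forall h l,
  [/\ cgf_strictly_convex P (Y h l), cgf_continuous P (Y h l) &
      cgf_steep P (Y h l)].

Definition assumption3 : Prop :=
  forall (l : 'I_q) (best worst : 'I_k),
    best = 0%N :> nat -> worst = k.-1 :> nat ->
    `[y (rk l worst) l, y (rk l best) l]%classic
      `<=` \bigcap_(h in [set: 'I_k]) (cgf_slopes P (Y h l))°.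

(* The budget [T] is a natural number; ratios are rounded down to a number of
   replications. *)
Definition nb_rep (a : R) (T : nat) : nat := Num.truncn (a * T%:R).

(* The comparison fails when one of the two sample means is over an empty
   sample. Hence a pair with ratio 0 makes the probability of false selection
   equal to 1 and its rate equal to 0; for positive ratios this case disappears
   once [T] is large. *)
Definition misordered (h h' : 'I_k) (l : 'I_q) (n n' : nat) : set Omega :=
  [set w | n = 0%N \/ n' = 0%N \/
           sample_mean (Y h l) n w <= sample_mean (Y h' l) n' w].

Definition false_selection (r : 'I_k -> 'I_q -> R) (T : nat) (l : 'I_q) :
    set Omega :=
  \bigcup_(i in [set i : 'I_k | (i < m)%N])
    \bigcup_(j in [set j : 'I_k | (m <= j)%N])
      misordered (rk l i) (rk l j) l
        (nb_rep (r (rk l i) l) T) (nb_rep (r (rk l j) l) T).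

Definition PFS_W (r : 'I_k -> 'I_q -> R) (T : nat) : \bar R :=
  \big[maxe/-oo%E]_(l < q) P (false_selection r T l).

Definition LD_rate (r : 'I_k -> 'I_q -> R) : \bar R :=
  (- lim (((T%:R^-1)%:E * lne (PFS_W r T)) @[T --> \oo]))%E.

Definition feasible (r : 'I_k -> 'I_q -> R) : Prop :=
  (forall h l, 0 <= r h l) /\ \sum_(h < k) \sum_(l < q) r h l = 1.

Definition asymptotically_optimal (r : 'I_k -> 'I_q -> R) : Prop :=
  feasible r /\ forall r', feasible r' -> (LD_rate r' <= LD_rate r)%E.

End Selection.

Section Balance.
Context (R : realType) (k q m : nat) (y sigma : 'I_k -> 'I_q -> R)
  (rk : 'I_q -> {perm 'I_k}) (r : 'I_k -> 'I_q -> R).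

(* Division by 0 yields 0, so this is the intended value only when both ratios
   are positive, as is the case at an optimum. *)
Definition G (i j : 'I_k) (l : 'I_q) : R :=
  (y (rk l i) l - y (rk l j) l) ^+ 2
  / (sigma (rk l i) l ^+ 2 / r (rk l i) l
     + sigma (rk l j) l ^+ 2 / r (rk l j) l).

(* Minima over nonempty ranges when [0 < m < k]; the neutral element [+oo]
   then plays no role. *)
Definition minG_over_j (i : 'I_k) (l : 'I_q) : \bar R :=
  \big[mine/+oo%E]_(j < k | (m <= j)%N) (G i j l)%:E.

Definition minG_over_i (j : 'I_k) (l : 'I_q) : \bar R :=
  \big[mine/+oo%E]_(i < k | (i < m)%N) (G i j l)%:E.

End Balance.

(* Main.v *)
(* For independent normal replications, the difference of two sample means has
   the moment generating function of a normal variable of mean [mu], the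
   difference of the true means, and variance [v] of order [1 / T].  The
   moment generating function alone yields the Chernoff upper bound and, by
   exponential tilting, a matching lower bound for the probability of a wrong
   order; hence the large deviations rate is half the minimum [z] of the [G]'s
   when all ratios are positive, and 0 otherwise.  So an optimal [r] is positive
   and maximises this minimum, and since [G] is homogeneous of degree 1, no
   allocation of budget less than 1 keeps all the [G]'s at or above [z].  Two
   savings are thereby excluded.  If no pair containing some design were tight,
   its ratio could be decreased.  And shifting [sigma ^+ 2 / r] by [- t] for the
   top designs of a context and by [+ t] for the other ones leaves every [G]
   unchanged, so the derivative of the budget at [t = 0], which is the difference
   of the two sums of the balance equation, must vanish. *)
Require Import Defs.
From HB Require Import structures.
From mathcomp Require Import all_boot all_order all_algebra all_fingroup.
From mathcomp Require Import all_classical all_reals all_analysis.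
From mathcomp Require Import measurable_realfun ring lra.

Set Implicit Arguments.
Unset Strict Implicit.
Unset Printing Implicit Defensive.

Import Order.TTheory GRing.Theory Num.Theory.
Import numFieldNormedType.Exports.

Local Open Scope classical_set_scope.
Local Open Scope ring_scope.

(** * Expectations: transfer, products of independent variables, normal moment generating
    function *)

Import HBNNSimple.

(* Both the passage to a density and the factorisation of expectations of
   independent variables are instances of this transfer from indicators to
   nonnegative measurable functions. *)
Lemma ge0_integral_transfer d1 d2 (T1 : measurableType d1)
    (T2 : measurableType d2) (R : realType)
    (mu : {measure set T1 -> \bar R}) (nu : {measure set T2 -> \bar R})
    (phi : T1 -> T2) (Z : T1 -> R) (c : R) (f : T2 -> R) :
  measurable_fun setT phi -> measurable_fun setT Z -> (forall x, 0 <= Z x) ->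
  (forall A, measurable A ->
    (\int[mu]_x (\1_A (phi x) * Z x)%:E = c%:E * nu A)%E) ->
  measurable_fun setT f -> (forall y, 0 <= f y) ->
  (\int[mu]_x (f (phi x) * Z x)%:E = c%:E * \int[nu]_y (f y)%:E)%E.
Proof.
move=> mphi mZ Z0 HA mf f0.
have /measurable_EFinP mfE := mf.
pose f_ := nnsfun_approx measurableT mfE.
have cf y : (EFin \o (fun n => f_ n y)) n @[n --> \oo] --> (f y)%:E.
  by apply: (cvg_nnsfun_approx measurableT mfE) => // z _; rewrite lee_fin.
have mfphi n : measurable_fun setT (fun x => f_ n (phi x) * Z x).
  by apply: measurable_funM => //; apply: measurableT_comp.
have simple n :
    (\int[mu]_x (f_ n (phi x) * Z x)%:E = c%:E * \int[nu]_y (f_ n y)%:E)%E.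
  have m1 r : measurable (f_ n @^-1` [set r]) by exact: measurable_sfunP.
  have mind r : measurable_fun setT (fun x => \1_(f_ n @^-1` [set r]) (phi x) : R).
    exact: (@measurableT_comp _ _ _ _ _ _ (\1_(f_ n @^-1` [set r]) : T2 -> R)).
  transitivity (\int[mu]_x (\sum_(r \in range (f_ n))
      (r * \1_(f_ n @^-1` [set r]) (phi x) * Z x)%:E))%E.
    apply: eq_integral => x _; rewrite fsumEFin//; congr (_%:E).
    by rewrite fimfunE !fsbig_finite//= mulr_suml.
  rewrite ge0_integral_fsum//; last 2 first.
  - move=> r; apply/measurable_EFinP; apply: measurable_funM => //.
    by apply: measurable_funM => //; exact: mind.
  - move=> r x _; rewrite lee_fin mulr_ge0// -lee_fin EFinM.
    exact: nnfun_muleindic_ge0.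
  rewrite integral_nnsfun// patch_setT sintegralE.
  rewrite !fsbig_finite//= ge0_sume_distrr; last first.
    by move=> r _; exact: nnsfun_mulemu_ge0.
  apply: eq_bigr => r _.
  (* A negative [r] is not a value of [f_ n]: its preimage is empty and both sides vanish. Otherwise
     [r] is a nonnegative constant and can be pulled out of the integral. *)
  rewrite muleCA -HA//; have [r0|r0] := ltP r 0.
    rewrite preimage_nnfun0//.
    by rewrite !integral0_eq ?mule0// => x _; rewrite indic0 ?mulr0 mul0r.
  rewrite -ge0_integralZl_EFin//.
  - by apply: eq_integral => x _; rewrite -EFinM mulrA.
  - by move=> x _; rewrite lee_fin mulr_ge0.
  - by apply/measurable_EFinP; apply: measurable_funM => //; exact: mind.
transitivity (limn (fun n => \int[mu]_x (f_ n (phi x) * Z x)%:E))%E.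
  rewrite -monotone_convergence//.
  - apply: eq_integral => x _; apply/esym/cvg_lim => //=.
    rewrite EFinM; under eq_fun do rewrite EFinM.
    by apply: cvgeZr => //; exact: cf.
  - by move=> n; exact/measurable_EFinP.
  - by move=> n x _; rewrite lee_fin mulr_ge0.
  - move=> x _ m n mn; rewrite lee_fin ler_wpM2r//.
    exact/lefP/nd_nnsfun_approx.
rewrite (eq_fun simple); apply/cvg_lim => //; apply: cvgeZl => //.
have -> : (\int[nu]_y (f y)%:E = \int[nu]_y limn (fun n => (f_ n y)%:E))%E.
  by apply: eq_integral => y _; apply/esym/cvg_lim => //; exact: cf.
apply: cvg_monotone_convergence => //.
- by move=> n; exact/measurable_EFinP.
- by move=> n x _; rewrite lee_fin.
- by move=> x _ m n mn; rewrite lee_fin; exact/lefP/nd_nnsfun_approx.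
Qed.

(** Independence is the case where all factors are indicators. The statement [mixed] allows
    functions on [s1] and indicators on [s2], and the induction on [s1] turns one indicator at a
    time into a function by the transfer lemma. *)
Lemma expectation_prod_indep d (Omega : measurableType d) (R : realType)
    (P : probability Omega R) (I : eqType) (X : I -> {RV P >-> R})
    (f : I -> R -> R) (e : I -> R) :
  mutually_independent P (fun i => X i : Omega -> R) ->
  (forall i, measurable_fun setT (f i)) -> (forall i y, 0 <= f i y) ->
  (forall i, \int[P]_w (f i (X i w))%:E = (e i)%:E)%E ->
  forall s, uniq s ->
    (\int[P]_w (\prod_(i <- s) f i (X i w))%:E = (\prod_(i <- s) e i)%:E)%E.
Proof.
move=> indep mf f0 fe.
have mX i : measurable_fun setT (X i) by exact: measurable_funP.
have mpre i (B : set R) : measurable B -> measurable (X i @^-1` B).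
  by move=> mB; rewrite -[_ @^-1` _]setTI; exact: mX.
have mind (i : I) (B : set R) : measurable B ->
    measurable_fun setT (fun w => \1_B (X i w) : R).
  by move=> mB; exact: (@measurableT_comp _ _ _ _ _ _ (\1_B : R -> R)).
have mixed s1 : forall s2 (A : I -> set R), (forall i, measurable (A i)) ->
    uniq (s1 ++ s2) ->
    (\int[P]_w (\prod_(i <- s1) f i (X i w)
                * \prod_(i <- s2) \1_(A i) (X i w))%:E
     = (\prod_(i <- s1) e i * \prod_(i <- s2) fine (P (X i @^-1` A i)))%:E)%E.
  elim: s1 => [|i s1 IH] s2 A mA.
    move=> /= us; rewrite big_nil mul1r.
    have mcap : measurable (\big[setI/setT]_(i <- s2) (X i @^-1` A i)).
      by apply: bigsetI_measurable => i _; exact: mpre.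
    have prodE : (\prod_(i <- s2) fine (P (X i @^-1` A i)))%:E =
        P (\big[setI/setT]_(i <- s2) (X i @^-1` A i)).
      rewrite indep// (big_morph EFin (@EFinM R) erefl).
      apply: eq_bigr => i _; rewrite fineK//; apply: fin_num_measure.
      exact: mpre.
    rewrite prodE -[in RHS](setIT (bigop.body _ _ _)) -integral_indic//.
    apply: eq_integral => w _; rewrite big_nil mul1r; congr (_%:E).
    rewrite (big_morph (fun B : set Omega => \1_B w : R) (id1 := 1) (op1 := *%R)).
    - by apply: eq_bigr => i _; rewrite !indicE.
    - by move=> B C; rewrite indicI.
    - by rewrite indicT.
  rewrite cat_cons cons_uniq mem_cat negb_or => /andP[/andP[is1 is2] us].
  pose Z w := \prod_(j <- s1) f j (X j w) * \prod_(j <- s2) \1_(A j) (X j w).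
  pose c := \prod_(j <- s1) e j * \prod_(j <- s2) fine (P (X j @^-1` A j)).
  have Z0 w : 0 <= Z w by rewrite mulr_ge0 ?prodr_ge0.
  have mZ : measurable_fun setT Z.
    apply: measurable_funM; apply: measurable_prod => j _; last exact: mind.
    exact: measurableT_comp.
  transitivity (\int[P]_w (f i (X i w) * Z w)%:E)%E.
    by apply: eq_integral => w _; rewrite big_cons mulrA.
  rewrite (@ge0_integral_transfer _ _ _ _ _ _ (distribution P (X i)) _ _ c)//.
  - rewrite (@ge0_integral_distribution _ _ _ _ _ _ (X i) (EFin \o f i))//.
    + by rewrite fe -EFinM big_cons /c; congr (_%:E); ring.
    + exact/measurable_EFinP.
    + by move=> y; rewrite lee_fin.
  (* The transfer asks for the indicator of [B] at [i]. The induction hypothesis provides it with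
     [i] moved to the indicator list; as [i] is not in [s2], the sets attached to [s2] do not
     change. *)
  - move=> B mB; pose A' j := if j == i then B else A j.
    have mA' j : measurable (A' j) by rewrite /A'; case: ifP.
    have A'i : A' i = B by rewrite /A' eqxx.
    have A'E j : j \in s2 -> A' j = A j.
      by rewrite /A'; case: eqP => // ->; rewrite (negbTE is2).
    have := IH (i :: s2) A' mA'.
    rewrite uniq_catC cat_cons cons_uniq mem_cat negb_or is1 is2 uniq_catC us.
    move=> /(_ isT); rewrite big_cons A'i => IHB.
    transitivity (\int[P]_w (\prod_(j <- s1) f j (X j w) *
        \prod_(j <- i :: s2) \1_(A' j) (X j w))%:E)%E.
      apply: eq_integral => w _; rewrite big_cons A'i /Z.
      have A'w : {in s2, forall j,
          \1_(A' j) (X j w) = \1_(A j) (X j w) :> R} by move=> j /A'E ->.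
      by rewrite (eq_big_seq _ A'w); congr (_%:E); ring.
    have A'P : {in s2, forall j,
        fine (P (X j @^-1` A' j)) = fine (P (X j @^-1` A j))} by move=> j /A'E ->.
    rewrite IHB (eq_big_seq _ A'P).
    rewrite -[X in (_ * X)%E]fineK; last exact: fin_num_measure.
    by rewrite -EFinM /c; congr (_%:E); rewrite /distribution/= /pushforward; ring.
move=> s us; have := mixed s [::] (fun=> setT) (fun=> measurableT).
rewrite cats0 big_nil mulr1 => /(_ us) <-.
by apply: eq_integral => w _; rewrite big_nil mulr1.
Qed.

(** Completing the square: [expR (a * x)] times the density of mean [mu] is a constant times the
    density of mean [mu + a * s ^+ 2], which has integral 1. *)
Lemma normal_mgf d (Omega : measurableType d) (R : realType)
    (P : probability Omega R) (X : {RV P >-> R}) (mu s : R) : 0 < s ->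
  (forall A : set R, measurable A -> distribution P X A = normal_prob mu s A) ->
  forall a, (\int[P]_w (expR (a * X w))%:E
             = (expR (a * mu + a ^+ 2 * s ^+ 2 / 2))%:E)%E.
Proof.
move=> s0 HX a; have sn0 : s != 0 by rewrite gt_eqF.
have mf : measurable_fun setT (fun x : R => expR (a * x)).
  by apply: measurableT_comp => //; apply: measurable_funM.
have <- := @ge0_integral_distribution _ _ _ _ _ _ X (fun x => (expR (a * x))%:E).
- rewrite -[LHS]mul1e -(@ge0_integral_transfer _ _ _ _ _ lebesgue_measure
    (distribution P X) idfun (normal_pdf mu s))//.
  + transitivity (\int[lebesgue_measure]_(x in setT)
        ((expR (a * mu + a ^+ 2 * s ^+ 2 / 2))%:E
         * (normal_pdf (mu + a * s ^+ 2) s x)%:E))%E.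
      apply: eq_integral => x _; rewrite -EFinM !normal_pdfE// /normal_fun.
      congr (_%:E); rewrite /= mulrCA [RHS]mulrCA -!expRD; congr (_ * expR _).
      by field.
    rewrite ge0_integralZl_EFin//.
    * by rewrite integral_normal_pdf mule1.
    * by move=> x _; rewrite lee_fin normal_pdf_ge0.
    * by apply/measurable_EFinP; exact: measurable_normal_pdf.
  + by move=> _ B mB; rewrite setTI.
  + exact: measurable_normal_pdf.
  + exact: normal_pdf_ge0.
  + move=> A mA; rewrite mul1e; apply: etrans (esym (HX A mA)).
    rewrite /normal_prob [RHS]integral_mkcond.
    apply: eq_integral => x _; rewrite epatch_indic/= -EFinM mulrC//.
- exact/measurable_EFinP.
- by move=> y; rewrite lee_fin expR_ge0.
Qed.

(** * Tail bounds from a Gaussian moment generating function *)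

Section gaussian_tail.
Context d (Omega : measurableType d) (R : realType) (P : probability Omega R).
Variables (W : Omega -> R) (mu v : R).
Hypotheses (mW : measurable_fun setT W) (mu0 : 0 < mu) (v0 : 0 < v).
Hypothesis mgfW : forall a,
  (\int[P]_w (expR (a * W w))%:E = (expR (a * mu + a ^+ 2 * v / 2))%:E)%E.

Let A := [set w | W w <= 0].

Let mA : measurable A.
Proof.
rewrite (_ : A = W @^-1` `]-oo, 0]%classic); last first.
  by apply/seteqP; split => w /=; rewrite in_itv.
by rewrite -[_ @^-1` _]setTI; exact: mW.
Qed.

Let mexp a : measurable_fun setT (fun w => (expR (a * W w))%:E).
Proof.
by apply/measurable_EFinP; apply: measurableT_comp => //; exact: measurable_funM.
Qed.

(** Chernoff bound at [a = - (mu / v)], the minimiser of [a * mu + a ^+ 2 * v / 2]. *)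
Lemma gaussian_tail_le : (P A <= (expR (- (mu ^+ 2 / (2 * v))))%:E)%E.
Proof.
have vn0 : v != 0 by rewrite gt_eqF.
rewrite -[X in P X]setIT -integral_indic//.
apply: (@le_trans _ _ (\int[P]_w (expR (- (mu / v) * W w))%:E)%E).
  apply: ge0_le_integral => //=.
  - by apply/measurable_EFinP; exact: measurable_indic.
  move=> w _; rewrite lee_fin indicE; case: (boolP (w \in A)) => [|_].
    rewrite inE => wA; rewrite -expR0 ler_expR mulNr oppr_ge0.
    by rewrite mulr_ge0_le0// ltW// divr_gt0.
  exact: expR_ge0.
by rewrite mgfW lee_fin ler_expR le_eqVlt; apply/orP; left; apply/eqP; field.
Qed.

(* Exponential tilting: under the density proportional to [expR (a * W)] with
   [a = - (mu + delta) / v], [W] concentrates around [- delta], and Chernoff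
   bounds at [a + delta / v] and [a - delta / v] control the mass lying outside
   [`[- 2 * delta, 0]]. *)
Lemma gaussian_tail_ge delta : 0 < delta ->
  4 * expR (- (delta ^+ 2 / (2 * v))) <= 1 ->
  ((expR (- ((mu ^+ 2 + 4 * mu * delta + 3 * delta ^+ 2) / (2 * v))) / 2)%:E
   <= P A)%E.
Proof.
move=> d0 small; have vn0 : v != 0 by rewrite gt_eqF.
pose a := - ((mu + delta) / v); pose t := delta / v.
pose K := expR (- (2 * a * delta)); pose L := expR (- (2 * t * delta)).
have t0 : 0 < t by rewrite divr_gt0.
have a0 : a < 0 by rewrite oppr_lt0 divr_gt0// addr_gt0.
(* Integrated form of a pointwise bound on [expR (a * W)]: the [a + t] term dominates where [W > 0],
   the [a - t] term where [W < - (2 * delta)], and the constant [K] in between, because [a < 0]. *)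
have key : ((expR (a * mu + a ^+ 2 * v / 2))%:E <=
    K%:E * P A + (expR ((a + t) * mu + (a + t) ^+ 2 * v / 2))%:E
    + L%:E * (expR ((a - t) * mu + (a - t) ^+ 2 * v / 2))%:E)%E.
  rewrite -[X in P X]setIT -integral_indic// -(mgfW a) -(mgfW (a + t)) -(mgfW (a - t)).
  have m1 : measurable_fun setT (fun w => (\1_A w)%:E : \bar R).
    by apply/measurable_EFinP; exact: measurable_indic.
  rewrite -ge0_integralZl_EFin ?expR_ge0//.
  rewrite -ge0_integralZl_EFin ?expR_ge0//.
  have mK : measurable_fun setT (fun w => K%:E * (\1_A w)%:E)%E.
    exact: measurable_funeM.
  have mL : measurable_fun setT
      (fun w => L%:E * (expR ((a - t) * W w))%:E)%E by exact: measurable_funeM.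
  have K0 w : (0 <= K%:E * (\1_A w)%:E)%E by rewrite -EFinM lee_fin mulr_ge0 ?expR_ge0.
  have L0 w : (0 <= L%:E * (expR ((a - t) * W w))%:E)%E.
    by rewrite -EFinM lee_fin mulr_ge0 ?expR_ge0.
  have E0 w : (0 <= (expR ((a + t) * W w))%:E)%E by rewrite lee_fin expR_ge0.
  rewrite -ge0_integralD// -ge0_integralD//; first last.
  - exact: emeasurable_funD.
  - by move=> w _; exact: adde_ge0.
  apply: ge0_le_integral => //=.
  - by apply: emeasurable_funD => //; exact: emeasurable_funD.
  move=> w _; rewrite -!EFinM -!EFinD lee_fin.
  have e1 := expR_ge0 ((a + t) * W w).
  have e2 : 0 <= L * expR ((a - t) * W w) by rewrite mulr_ge0 ?expR_ge0.
  have e3 : 0 <= K * \1_A w by rewrite mulr_ge0 ?expR_ge0.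
  have [W0|W0] := ltP 0 (W w).
    have : expR (a * W w) <= expR ((a + t) * W w) by rewrite ler_expR; nra.
    lra.
  have [W1|W1] := ltP (W w) (- (2 * delta)).
    have : expR (a * W w) <= L * expR ((a - t) * W w).
      by rewrite /L -expRD ler_expR; nra.
    lra.
  rewrite indicE mem_set// mulr1.
  have : expR (a * W w) <= K by rewrite ler_expR; nra.
  by move: e1 e2; lra.
set M := expR (a * mu + a ^+ 2 * v / 2) in key.
have ME e : M * expR e = expR (- ((mu ^+ 2 - delta ^+ 2) / (2 * v)) + e).
  by rewrite /M -expRD; congr expR; rewrite /a; field.
have M1 : expR ((a + t) * mu + (a + t) ^+ 2 * v / 2)
    = M * expR (- (delta ^+ 2 / (2 * v))).
  by rewrite ME; congr expR; rewrite /a /t; field.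
have M2 : L * expR ((a - t) * mu + (a - t) ^+ 2 * v / 2)
    = M * expR (- (delta ^+ 2 / (2 * v))).
  by rewrite ME /L -expRD; congr expR; rewrite /a /t; field.
have pfin : P A \is a fin_num by exact: fin_num_measure.
move: key; rewrite -EFinM M1 M2 -(fineK pfin) -EFinM -!EFinD !lee_fin.
set p := fine _; set ep := expR _ in small *; move=> key.
have M0 : 0 < M by exact: expR_gt0.
(* Each outer term equals [M * ep] with [ep <= 1 / 4], so together they take at most half of [M]. *)
have Kp : M / 2 <= K * p by nra.
have -> : expR (- ((mu ^+ 2 + 4 * mu * delta + 3 * delta ^+ 2) / (2 * v)))
    = M / K.
  by rewrite /K -expRN opprK ME; congr expR; rewrite /a; field.
by rewrite mulrAC ler_pdivrMr ?expR_gt0// [p * _]mulrC.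
Qed.

End gaussian_tail.

(** * Union bound, logarithmic limits and rounding of the numbers of replications *)

Lemma measure_bigcup_fin_le d (T : measurableType d) (R : realType)
    (mu : {measure set T -> \bar R}) (I : finType) (D : set I)
    (A : I -> set T) (b : R) :
  (forall i, D i -> measurable (A i)) ->
  (forall i, D i -> (mu (A i) <= b%:E)%E) -> 0 <= b ->
  (mu (\bigcup_(i in D) A i) <= (#|I|%:R * b)%:E)%E.
Proof.
move=> mA Ab b0; pose A' i := if i \in D then A i else set0.
have mA' i : measurable (A' i).
  by rewrite /A'; case: ifPn => // /set_mem; exact: mA.
have A'b i : (mu (A' i) <= b%:E)%E.
  by rewrite /A'; case: ifPn => [/set_mem/Ab//|_]; rewrite measure0 lee_fin.
have -> : \bigcup_(i in D) A i = \big[setU/set0]_(i <- enum I) A' i.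
  rewrite -bigcup_seq; apply/seteqP; split => x [i].
    by move=> Di Aix; exists i; rewrite /= ?mem_enum// /A' mem_set.
  by rewrite /A' => _; case: ifPn => // /set_mem Di Aix; exists i.
rewrite cardE; elim: (enum I) => [|i s IH].
  by rewrite big_nil measure0 mul0r.
rewrite big_cons -[size _]/(size s).+1 -[(size s).+1]add1n natrD mulrDl mul1r.
rewrite EFinD; apply: le_trans (leeD (A'b i) IH).
by apply: measureU2 => //; apply: bigsetU_measurable.
Qed.

(** The constants contribute [ln N / T] and [ln c / T], which vanish in the limit; for large [T]
    they are absorbed by half of the tolerance [e]. *)
Lemma cvg_inv_lne (R : realType) (p : nat -> \bar R) (z N c : R) :
  0 < N -> 0 < c ->
  (forall e, 0 < e ->
    \forall T \near \oo, (p T <= (N * expR (- ((z - e) * T%:R)))%:E)%E) ->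
  (forall e, 0 < e ->
    \forall T \near \oo, ((c * expR (- ((z + e) * T%:R)))%:E <= p T)%E) ->
  ((T%:R^-1)%:E * lne (p T))%E @[T --> \oo] --> (- z)%:E.
Proof.
move=> N0 c0 up lo.
have pE : \forall T \near \oo, p T = (fine (p T))%:E /\ 0 < fine (p T).
  near=> T.
  have u : (p T <= (N * expR (- ((z - 1) * T%:R)))%:E)%E by near: T; exact: up.
  have l : ((c * expR (- ((z + 1) * T%:R)))%:E <= p T)%E by near: T; exact: lo.
  have fp : p T \is a fin_num.
    rewrite fin_numElt (le_lt_trans u) ?ltry// (lt_le_trans _ l)// ltNyr//.
  split; first by rewrite fineK.
  by rewrite -lte_fin fineK//; apply: lt_le_trans l; rewrite lte_fin mulr_gt0// expR_gt0.
apply: cvg_EFin.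
  by apply: filterS pE => T [-> p0]; rewrite lne_EFin.
apply/cvgrPdist_le => e e0; have e2 : 0 < e / 2 by rewrite divr_gt0.
near=> T.
have T0 : 0 < T%:R :> R by rewrite ltr0n; near: T; exact: nbhs_infty_gt.
have [pT p0] : p T = (fine (p T))%:E /\ 0 < fine (p T).
  by near: T.
have u : (p T <= (N * expR (- ((z - e / 2) * T%:R)))%:E)%E by near: T; exact: up.
have l : ((c * expR (- ((z + e / 2) * T%:R)))%:E <= p T)%E by near: T; exact: lo.
have TN : ln N * 2 / e <= T%:R by near: T; exact: nbhs_infty_ger.
have Tc : - ln c * 2 / e <= T%:R by near: T; exact: nbhs_infty_ger.
rewrite /= pT lne_EFin//= ler_norml.
rewrite pT !lee_fin in u l.
have {}u : ln (fine (p T)) <= ln N + - ((z - e / 2) * T%:R).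
  rewrite -[X in _ + X]expRK -lnM ?posrE ?expR_gt0// ler_ln ?posrE//.
  by rewrite mulr_gt0// expR_gt0.
have {}l : ln c + - ((z + e / 2) * T%:R) <= ln (fine (p T)).
  rewrite -[X in _ + X]expRK -lnM ?posrE ?expR_gt0// ler_ln ?posrE//.
  by rewrite mulr_gt0// expR_gt0.
rewrite ler_pdivrMr// in TN; rewrite ler_pdivrMr// in Tc.
set L := ln (fine (p T)) in u l *.
have -> : - z - T%:R^-1 * L = (- z * T%:R - L) / T%:R by field; rewrite gt_eqF.
by rewrite ler_pdivlMr// ler_pdivrMr//; apply/andP; split; nra.
Unshelve. all: by end_near. Qed.

Lemma nb_rep_near (R : realType) (a eta : R) : 0 < a -> 0 < eta < 1 ->
  \forall T \near \oo, [/\ (0 < nb_rep a T)%N,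
    (1 - eta) * a * T%:R <= (nb_rep a T)%:R & (nb_rep a T)%:R <= a * T%:R].
Proof.
move=> a0 /andP[eta0 eta1]; near=> T.
have T1 : 1 / a <= T%:R by near: T; exact: nbhs_infty_ger.
(* Rounding down loses less than 1, which is then at most [eta * a * T]. *)
have T2 : 1 / (a * eta) <= T%:R by near: T; exact: nbhs_infty_ger.
rewrite ler_pdivrMr// in T1; rewrite ler_pdivrMr ?mulr_gt0// in T2.
have aT0 : 0 <= a * T%:R by rewrite mulr_ge0// ltW.
have lt := truncnS_gt (a * T%:R); rewrite -/(nb_rep a T) -natr1 in lt.
have le : (nb_rep a T)%:R <= a * T%:R by rewrite truncn_le.
split => //; first by rewrite truncn_gt0 mulrC.
nra.
Unshelve. all: by end_near. Qed.

(** * Large deviations rate of the probability of false selection *)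

Section large_deviations.
Context (d : measure_display) (Omega : measurableType d) (R : realType)
  (P : probability Omega R) (k q m : nat) (y sigma : 'I_k -> 'I_q -> R)
  (rk : 'I_q -> {perm 'I_k}) (Y : 'I_k -> 'I_q -> nat -> {RV P >-> R}).
Hypothesis sigma_gt0 : forall h l, 0 < sigma h l.
Hypothesis normalY : forall h l t (A : set R), measurable A ->
  distribution P (Y h l t) A = normal_prob (y h l) (sigma h l) A.
Hypothesis indepY : mutually_independent P
  (fun a : 'I_k * 'I_q * nat => Y a.1.1 a.1.2 a.2 : Omega -> R).

Let YY h l t : Omega -> R := Y h l t.

Lemma measurable_sample_mean h l n :
  measurable_fun setT (sample_mean (YY h l) n).
Proof.
by apply: measurable_funM => //; apply: measurable_sum => t; exact: measurable_funP.
Qed.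

Lemma mgf_sample_mean_diff h h' l n n' : h != h' -> (0 < n)%N -> (0 < n')%N ->
  forall a,
  (\int[P]_w (expR (a * (sample_mean (YY h l) n w
                         - sample_mean (YY h' l) n' w)))%:E
   = (expR (a * (y h l - y h' l)
            + a ^+ 2 * (sigma h l ^+ 2 / n%:R + sigma h' l ^+ 2 / n'%:R) / 2))%:E)%E.
Proof.
move=> hh' n0 n'0 a.
(* The weight may depend on the design alone, since [s] lists replications of [h] and [h'] only. *)
pose b (i : 'I_k * 'I_q * nat) := if i.1.1 == h then a / n%:R else - (a / n'%:R).
pose s := [seq (h, l, t) | t <- iota 0 n] ++ [seq (h', l, t) | t <- iota 0 n'].
have us : uniq s.
  rewrite cat_uniq !map_inj_uniq ?iota_uniq/= ?andbT; try by move=> ? ? [].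
  apply/hasPn => _ /mapP[t _ ->]; apply/negP => /mapP[t' _] [] /eqP.
  by rewrite eq_sym (negbTE hh').
have sumE (F : 'I_k * 'I_q * nat -> R) : \sum_(i <- s) F i =
    \sum_(t < n) F (h, l, t : nat) + \sum_(t < n') F (h', l, t : nat).
  rewrite big_cat/= !big_map.
  by rewrite -{1}[n]subn0 -{1}[n']subn0 -!/(index_iota 0 _) !big_mkord.
have := @expectation_prod_indep _ _ _ P _ (fun i => Y i.1.1 i.1.2 i.2)
  (fun i x => expR (b i * x))
  (fun i => expR (b i * y i.1.1 i.1.2 + b i ^+ 2 * sigma i.1.1 i.1.2 ^+ 2 / 2))
  indepY _ _ _ s us.
rewrite -expR_sum sumE /b/= eqxx eq_sym (negbTE hh').
under eq_integral do rewrite -expR_sum sumE /b/= eqxx eq_sym (negbTE hh').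
rewrite !sumr_const !card_ord => E.
have nn0 : n%:R != 0 :> R by rewrite pnatr_eq0 -lt0n.
have nn'0 : n'%:R != 0 :> R by rewrite pnatr_eq0 -lt0n.
transitivity ((expR ((a / n%:R * y h l + (a / n%:R) ^+ 2 * sigma h l ^+ 2 / 2) *+ n
   + (- (a / n'%:R) * y h' l + (- (a / n'%:R)) ^+ 2 * sigma h' l ^+ 2 / 2) *+ n'))%:E).
  rewrite -E.
  - apply: eq_integral => w _; congr (expR _)%:E.
    rewrite /sample_mean -!mulr_sumr; field.
    by rewrite nn0 nn'0.
  - by move=> i; apply: measurableT_comp => //; exact: measurable_funM.
  - by move=> i x; exact: expR_ge0.
  - by move=> i; apply: normal_mgf => // A; exact: normalY.
congr ((expR _)%:E); rewrite -(mulr_natr _ n) -(mulr_natr _ n'); field.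
by rewrite nn0 nn'0.
Qed.

Lemma measurable_misordered h h' l n n' :
  measurable (misordered YY h h' l n n').
Proof.
pose A := [set w | sample_mean (YY h l) n w - sample_mean (YY h' l) n' w <= 0].
have mA : measurable A.
  rewrite (_ : A = (fun w => sample_mean (YY h l) n w - sample_mean (YY h' l) n' w)
     @^-1` `]-oo, 0]%classic); last by apply/seteqP; split => w /=; rewrite in_itv.
  rewrite -[_ @^-1` _]setTI.
  apply: (measurable_funB (measurable_sample_mean h l n)
    (measurable_sample_mean h' l n')) => //.
have [->|n0] := eqVneq n 0%N.
  by rewrite (_ : misordered _ _ _ _ _ _ = setT)//; apply/seteqP; split => // w _; left.
have [->|n'0] := eqVneq n' 0%N.
  rewrite (_ : misordered _ _ _ _ _ _ = setT)//.
  by apply/seteqP; split => // w _; right; left.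
rewrite (_ : misordered _ _ _ _ _ _ = A)//; apply/seteqP; split => w /=.
  by case=> [/eqP|[/eqP|]]; rewrite ?(negbTE n0) ?(negbTE n'0)// /A/= subr_le0.
by rewrite /A/= subr_le0; right; right.
Qed.

Let pair_rate (a b : R) h h' l :=
  (y h l - y h' l) ^+ 2 / (2 * (sigma h l ^+ 2 / a + sigma h' l ^+ 2 / b)).

(** The numbers of replications lie within a factor [1 - eta] of [a * T] and [b * T], so the
    variance [w2] of the difference of means lies between [v / T] and [v / ((1 - eta) * T)]; the
    Gaussian tail bounds then apply with mean [D]. *)
Lemma misordered_near a b h h' l : h != h' -> y h' l < y h l -> 0 < a -> 0 < b ->
  forall e, 0 < e -> \forall T \near \oo,
  ((2^-1 * expR (- ((pair_rate a b h h' l + e) * T%:R)))%:E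
   <= P (misordered YY h h' l (nb_rep a T) (nb_rep b T))
   <= (expR (- ((pair_rate a b h h' l - e) * T%:R)))%:E)%E.
Proof.
move=> hh' yhh' a0 b0 e e0.
set s := sigma h l; set s' := sigma h' l.
have s0 : 0 < s by exact: sigma_gt0.
have s'0 : 0 < s' by exact: sigma_gt0.
pose v := s ^+ 2 / a + s' ^+ 2 / b; pose D := y h l - y h' l.
have v0 : 0 < v by rewrite addr_gt0// divr_gt0// exprn_gt0.
have D0 : 0 < D by rewrite subr_gt0.
have zE : pair_rate a b h h' l = D ^+ 2 / (2 * v) by [].
set z := pair_rate _ _ _ _ _ in zE *.
have z0 : 0 < z by rewrite zE divr_gt0 ?exprn_gt0 ?mulr_gt0.
have zv : z * (2 * v) = D ^+ 2 by rewrite zE; field; rewrite gt_eqF.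
(* Gives [z - e <= z * (1 - eta)] for the upper bound, while [1 - eta >= 1 / 2]. *)
pose eta := Num.min 2^-1 (e / z).
have eta0 : 0 < eta by rewrite lt_min invr_gt0 ltr0n divr_gt0.
have eta2 : eta <= 2^-1 by rewrite ge_min lexx.
have etaz : eta * z <= e by rewrite -ler_pdivlMr// ge_min lexx orbT.
have eta01 : 0 < eta < 1 by rewrite eta0/=; lra.
(* As [delta <= 1], the excess [4 * D * delta + 3 * delta ^+ 2] of the tilted lower bound is at most
   [2 * v * e]. *)
pose delta := Num.min 1 (2 * v * e / (4 * D + 3)).
have D43 : 0 < 4 * D + 3 by lra.
have delta0 : 0 < delta by rewrite lt_min ltr01 divr_gt0// !mulr_gt0.
have delta1 : delta <= 1 by rewrite ge_min lexx.
have deltae : delta * (4 * D + 3) <= 2 * v * e.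
  by rewrite -ler_pdivlMr// ge_min lexx orbT.
near=> T.
have [n0 n1 n2] : [/\ (0 < nb_rep a T)%N,
    (1 - eta) * a * T%:R <= (nb_rep a T)%:R & (nb_rep a T)%:R <= a * T%:R].
  by near: T; exact: nb_rep_near.
have [n'0 n'1 n'2] : [/\ (0 < nb_rep b T)%N,
    (1 - eta) * b * T%:R <= (nb_rep b T)%:R & (nb_rep b T)%:R <= b * T%:R].
  by near: T; exact: nb_rep_near.
have T0 : 0 < T%:R :> R by rewrite ltr0n; near: T; exact: nbhs_infty_gt.
(* With [w2 * T <= 2 * v] this yields [delta ^+ 2 / (2 * w2) >= 3], whose exponential is at least 4,
   as the tilted bound requires. *)
have Tdelta : 12 * v / delta ^+ 2 <= T%:R by near: T; exact: nbhs_infty_ger.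
set n := nb_rep a T in n0 n1 n2 *; set n' := nb_rep b T in n'0 n'1 n'2 *.
pose w2 := s ^+ 2 / n%:R + s' ^+ 2 / n'%:R.
have w20 : 0 < w2 by rewrite addr_gt0// divr_gt0 ?exprn_gt0 ?ltr0n.
have ge_div (t c : R) (p : nat) : 0 < c -> (0 < p)%N -> p%:R <= c * T%:R ->
    t ^+ 2 / c <= t ^+ 2 / p%:R * T%:R.
  move=> c0 p0 pc; have := sqr_ge0 t; move: (t ^+ 2) => {}t t_ge0.
  rewrite ler_pdivrMr// -[leLHS]mulr1 -!mulrA.
  apply: ler_wpM2l => //.
  by rewrite mulrC ler_pdivlMr ?ltr0n// mul1r mulrC.
have le_div (t c : R) (p : nat) : 0 < c -> (0 < p)%N ->
    (1 - eta) * c * T%:R <= p%:R ->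
    t ^+ 2 / p%:R * ((1 - eta) * T%:R) <= t ^+ 2 / c.
  move=> c0 p0 pc; have := sqr_ge0 t; move: (t ^+ 2) => {}t t_ge0.
  rewrite ler_pdivlMr// -[leRHS]mulr1 -!mulrA.
  apply: ler_wpM2l => //.
  rewrite mulrC ler_pdivrMr ?ltr0n// mul1r.
  by rewrite [T%:R * c]mulrC mulrA.
have w2ge : v <= w2 * T%:R by rewrite /w2 mulrDl lerD ?ge_div.
have w2le : w2 * ((1 - eta) * T%:R) <= v by rewrite /w2 mulrDl lerD ?le_div.
have -> : misordered YY h h' l n n' =
    [set w | sample_mean (YY h l) n w - sample_mean (YY h' l) n' w <= 0].
  apply/seteqP; split => w /=; last by rewrite subr_le0; right; right.
  by case=> [n00|[n00|]]; rewrite ?subr_le0//; move: n0 n'0; rewrite n00.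
have mW := measurable_funB (measurable_sample_mean h l n)
  (measurable_sample_mean h' l n').
have mgf := mgf_sample_mean_diff l hh' n0 n'0.
have up := gaussian_tail_le mW D0 w20 mgf.
have lo := gaussian_tail_ge mW D0 w20 mgf delta0.
apply/andP; split; last first.
  apply: le_trans up _; rewrite lee_fin ler_expR lerN2.
  rewrite ler_pdivlMr ?mulr_gt0//.
  have : (z - e) * T%:R <= z * ((1 - eta) * T%:R) by nra.
  by rewrite -zv; nra.
apply: le_trans (lo _); last first.
  have : 3 <= delta ^+ 2 / (2 * w2).
    rewrite ler_pdivlMr ?mulr_gt0//.
    rewrite ler_pdivrMr ?exprn_gt0// in Tdelta.
    nra.
  have := expR_ge1Dx (delta ^+ 2 / (2 * w2)).
  rewrite expRN -ler_pdivlMr ?invr_gt0 ?expR_gt0// div1r invrK; lra.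
rewrite lee_fin mulrC ler_pM2r// ler_expR lerN2.
rewrite ler_pdivrMr ?mulr_gt0//.
have : D ^+ 2 + 4 * D * delta + 3 * delta ^+ 2 <= (z + e) * (2 * v).
  have dd : delta ^+ 2 <= delta by rewrite expr2 ler_piMl// ltW.
  rewrite [(z + e) * _]mulrDl zv; nra.
nra.
Unshelve. all: by end_near. Qed.

Hypothesis y_gap : forall l (i j : 'I_k), (i < m)%N -> (m <= j)%N ->
  y (rk l j) l < y (rk l i) l.

Let measurable_false_selection_i (r : 'I_k -> 'I_q -> R) T l (i : 'I_k) :
  measurable (\bigcup_(j in [set j : 'I_k | (m <= j)%N])
    misordered YY (rk l i) (rk l j) l
        (nb_rep (r (rk l i) l) T) (nb_rep (r (rk l j) l) T)).
Proof.
by apply: fin_bigcup_measurable => // j _; exact: measurable_misordered.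
Qed.

Lemma measurable_false_selection (r : 'I_k -> 'I_q -> R) T l :
  measurable (false_selection m YY rk r T l).
Proof. by apply: fin_bigcup_measurable. Qed.

(** The union bound over pairs gives the upper estimate, and the single pair attaining [z] gives the
    lower one. *)
Lemma LD_rate_gt0 (r : 'I_k -> 'I_q -> R) z : (forall h l, 0 < r h l) ->
  (forall l (i j : 'I_k), (i < m)%N -> (m <= j)%N ->
    z <= G y sigma rk r i j l / 2) ->
  (exists l, exists i j : 'I_k, [/\ (i < m)%N, (m <= j)%N &
    G y sigma rk r i j l / 2 = z]) ->
  LD_rate P m YY rk r = z%:E.
Proof.
move=> r0 zG [l0 [i0 [j0 [i0m mj0 z0]]]].
have pair (i j : 'I_k) l : (i < m)%N -> (m <= j)%N -> forall e, 0 < e ->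
    \forall T \near \oo,
    ((2^-1 * expR (- ((G y sigma rk r i j l / 2 + e) * T%:R)))%:E
     <= P (misordered YY (rk l i) (rk l j) l
          (nb_rep (r (rk l i) l) T) (nb_rep (r (rk l j) l) T))
     <= (expR (- ((G y sigma rk r i j l / 2 - e) * T%:R)))%:E)%E.
  move=> im mj e e0.
  have ij : rk l i != rk l j.
    by rewrite (inj_eq perm_inj); apply: contraTneq im => ->; rewrite -leqNgt.
  have := misordered_near ij (@y_gap l i j im mj)
    (r0 (rk l i) l) (r0 (rk l j) l) e0.
  by rewrite /pair_rate invfM [2^-1 * _]mulrC mulrA.
have k0 : 0 < k%:R :> R by rewrite ltr0n (leq_trans _ (ltn_ord i0)).
rewrite /LD_rate.
suff -> : lim (((T%:R^-1)%:E * lne (PFS_W P m YY rk r T))%E @[T --> \oo])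
    = (- z)%:E.
  by rewrite EFinN oppeK.
apply: cvg_lim => //.
(* The factor [k * k] counts pairs of ranks; contexts bring no factor because [PFS_W] is a maximum
   over them. *)
apply: (@cvg_inv_lne _ _ _ (k%:R * k%:R) 2^-1) => //; first exact: mulr_gt0.
- move=> e e0; near=> T.
  have up (x : 'I_q * 'I_k * 'I_k) : (x.1.2 < m)%N -> (m <= x.2)%N ->
     (P (misordered YY (rk x.1.1 x.1.2) (rk x.1.1 x.2) x.1.1
          (nb_rep (r (rk x.1.1 x.1.2) x.1.1) T)
          (nb_rep (r (rk x.1.1 x.2) x.1.1) T))
     <= (expR (- ((z - e) * T%:R)))%:E)%E.
    (* There are finitely many triples, so one threshold on [T] serves them all. *)
    move: x; near: T; apply: filter_forall => -[[l i] j] /=.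
    case: (ltnP i m) => im; last by near=> T.
    case: (leqP m j) => mj; last by near=> T.
    apply: filterS (pair i j l im mj _ e0) => T /andP[_ le] _ _.
    apply: le_trans le _; rewrite lee_fin ler_expR lerN2 ler_wpM2r//.
    by rewrite lerB// zG.
  apply: bigmax_le => [|l _]; first exact: leNye.
  rewrite -mulrA -[X in (X%:R * (_ * _))%:E](card_ord k).
  apply: measure_bigcup_fin_le => [i _|i /= im|]; last first.
  - by rewrite mulr_ge0// expR_ge0.
  - rewrite -[X in (X%:R * _)%:E](card_ord k).
    apply: measure_bigcup_fin_le => [j _|j /= mj|]; last exact: expR_ge0.
      exact: measurable_misordered.
    exact: (up (l, i, j)).
  - exact: measurable_false_selection_i.
- move=> e e0; apply: filterS (pair i0 j0 l0 i0m mj0 _ e0) => T /andP[le _].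
  rewrite z0 in le; apply: le_trans le _.
  apply: (@bigmax_sup _ _ _ _ l0) => //; apply: le_measure.
  - by rewrite inE; exact: measurable_misordered.
  - by rewrite inE; exact: measurable_false_selection.
  - by move=> w W; exists i0 => //; exists j0.
Unshelve. all: by end_near. Qed.

Lemma LD_rate_eq0 (r : 'I_k -> 'I_q -> R) : (0 < m < k)%N ->
  (exists h l, r h l = 0) ->
  LD_rate P m YY rk r = 0%E.
Proof.
move=> /andP[m0 mk] [h [l rhl]].
have nb0 T : nb_rep (r h l) T = 0%N.
  by rewrite /nb_rep rhl mul0r truncn0.
have fsT T : false_selection m YY rk r T l = setT.
  (* The unsampled design [h] forms a surely misordered pair: with rank [m] if [h] is among the top
     designs, with rank 0 otherwise. *)
  apply/seteqP; split => // w _; pose i := (rk l)^-1%g h.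
  have ri : rk l i = h by rewrite /i permKV.
  have [im|mi] := ltnP i m.
    exists i => //; exists (Ordinal mk); first by rewrite /=.
    by left; rewrite ri.
  exists (Ordinal (ltn_trans m0 mk)) => //; exists i => //.
  by right; left; rewrite ri.
have PFS1 T : PFS_W P m YY rk r T = 1%E.
  apply/eqP; rewrite eq_le; apply/andP; split.
    apply: bigmax_le => [|l' _]; first exact: leNye.
    by apply: probability_le1; exact: measurable_false_selection.
  apply: (@bigmax_sup _ _ _ _ l) => //.
  by rewrite fsT probability_setT.
rewrite /LD_rate; under eq_fun do rewrite PFS1 lne1 mule0.
by rewrite lim_cst// oppe0.
Qed.

End large_deviations.

(** * First-order conditions for an optimal allocation *)

(* With [a x = rho x * w x], the summand is [rho x / (1 - s x * t * w x) - rho x],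
   so the hypothesis says that [t = 0] is a local minimum and the conclusion is
   the first-order condition. *)
Lemma stationary_sum_eq0 (R : realFieldType) (I : finType) (s a w : I -> R) :
  (forall x, s x ^+ 2 = 1) -> (forall x, 0 <= a x) -> (forall x, 0 <= w x) ->
  (forall t, (forall x, `|t| * w x <= 2^-1) ->
     0 <= \sum_x t * (s x * a x / (1 - s x * t * w x))) ->
  \sum_x s x * a x = 0.
Proof.
move=> s2 a0 w0 H; set f := \sum_x s x * a x.
pose C := \sum_x 2 * a x * w x; pose V := \sum_x w x.
have C0 : 0 <= C by apply: sumr_ge0 => x _; rewrite !mulr_ge0.
have V0 : 0 <= V by exact: sumr_ge0.
have wV x : w x <= V.
  by rewrite /V (bigD1 x)//= lerDl sumr_ge0.
(* For [t = - f / K], the summand [2 * |f| * V] keeps [t] in the admissible range, and [K > C] makes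
   [t * f + t ^+ 2 * C] negative unless [f = 0]. *)
pose K := 1 + C + 2 * `|f| * V.
have K0 : 0 < K by rewrite /K; have := normr_ge0 f; nra.
apply/eqP; apply: contraT => f0.
have f2 : 0 < f ^+ 2 by rewrite exprn_even_gt0.
pose t := - f / K.
have tw x : `|t| * w x <= 2^-1.
  rewrite normrM normrN normfV (gtr0_norm K0) mulrAC ler_pdivrMr//.
  have : `|f| * w x <= `|f| * V by rewrite ler_wpM2l.
  rewrite /K; have := normr_ge0 f; nra.
have s1 x : `|s x| = 1.
  by apply/eqP; rewrite -sqrp_eq1// real_normK ?num_real// s2.
have den x : 2^-1 <= 1 - s x * t * w x.
  have : s x * t * w x <= `|t| * w x.
    by rewrite ler_wpM2r// (le_trans (ler_norm _))// normrM s1 mul1r.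
  have := tw x; lra.
have := H t tw.
(* Second-order expansion in [t]; the factor 2 in [C] bounds the inverse of the denominators. *)
have bound : \sum_x t * (s x * a x / (1 - s x * t * w x)) <= t * f + t ^+ 2 * C.
  rewrite /f /C !mulr_sumr -big_split/=; apply: ler_sum => x _.
  have d0 : 0 < 1 - s x * t * w x by apply: lt_le_trans (den x).
  have -> : t * (s x * a x / (1 - s x * t * w x))
     = t * (s x * a x) + t ^+ 2 * (s x ^+ 2 * a x * w x / (1 - s x * t * w x)).
    by field; rewrite gt_eqF.
  rewrite s2 mul1r lerD2l ler_wpM2l ?sqr_ge0// ler_pdivrMr//.
  have := den x; have := mulr_ge0 (a0 x) (w0 x); nra.
move=> /le_trans/(_ bound).
have -> : t * f + t ^+ 2 * C = - (f ^+ 2 / K) * (1 - C / K).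
  by rewrite /t; field; rewrite gt_eqF.
rewrite mulNr oppr_ge0 pmulr_rle0 ?divr_gt0// subr_le0 ler_pdivlMr// mul1r.
have fV : 0 <= `|f| * V by rewrite mulr_ge0.
by rewrite /K; lra.
Qed.

Section optimal_allocation.
Context (R : realType) (k q m : nat) (y sigma : 'I_k -> 'I_q -> R)
  (rk : 'I_q -> {perm 'I_k}).
Hypothesis sigma_gt0 : forall h l, 0 < sigma h l.
Hypothesis y_gap : forall l (i j : 'I_k), (i < m)%N -> (m <= j)%N ->
  y (rk l j) l < y (rk l i) l.

Lemma G_gt0 r (i j : 'I_k) l : (forall h l, 0 < r h l) ->
  (i < m)%N -> (m <= j)%N -> 0 < G y sigma rk r i j l.
Proof.
move=> r0 im mj; rewrite divr_gt0 ?exprn_gt0 ?subr_gt0 ?y_gap//.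
by rewrite addr_gt0 ?divr_gt0 ?exprn_gt0.
Qed.

Lemma G_scale r c (i j : 'I_k) l : 0 < c -> (forall h l, 0 < r h l) ->
  G y sigma rk (fun h l => c * r h l) i j l = c * G y sigma rk r i j l.
Proof.
move=> c0 r0; rewrite /G; field.
have a0 := sigma_gt0 (rk l i) l; have b0 := sigma_gt0 (rk l j) l.
have ra := r0 (rk l i) l; have rb := r0 (rk l j) l.
by rewrite !gt_eqF//= addr_gt0// mulr_gt0// exprn_gt0.
Qed.

Variables (r : 'I_k -> 'I_q -> R) (z : R).
Hypotheses (r_gt0 : forall h l, 0 < r h l)
  (r_sum : \sum_h \sum_l r h l = 1).
Hypothesis z_le : forall l (i j : 'I_k), (i < m)%N -> (m <= j)%N ->
  z <= G y sigma rk r i j l.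
Hypothesis z_max : forall r', (forall h l, 0 < r' h l) ->
  \sum_h \sum_l r' h l = 1 -> exists l, exists i j : 'I_k,
  [/\ (i < m)%N, (m <= j)%N & G y sigma rk r' i j l <= z].

(** If the budget [S] were below 1, scaling by [S^-1] would restore budget 1 and raise every [G]
    strictly above [z], against [z_max]. *)
Lemma budget_ge1 r' : (forall h l, 0 < r' h l) ->
  (forall l (i j : 'I_k), (i < m)%N -> (m <= j)%N ->
    z <= G y sigma rk r' i j l) ->
  1 <= \sum_h \sum_l r' h l.
Proof.
move=> r'0 zr'; rewrite leNgt; apply/negP; set S := \sum_h _ => S1.
(* Used at [r] to obtain a design and a context, whence [S > 0]. *)
have [l [i [j [im mj _]]]] := z_max r_gt0 r_sum.
have S0 : 0 < S.
  apply: (@lt_le_trans _ _ (r' i l)) => //.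
  rewrite /S (bigD1 i)//= (bigD1 l)//= -addrA lerDl addr_ge0//.
    by apply: sumr_ge0 => x _; exact: ltW.
  by apply: sumr_ge0 => x _; apply: sumr_ge0 => x' _; exact: ltW.
have Si0 : 0 < S^-1 by rewrite invr_gt0.
have [h l'|//|] := z_max (r' := fun h l => S^-1 * r' h l).
- by rewrite mulr_gt0.
- rewrite -(@mulVf _ S) ?gt_eqF// mulr_sumr; apply: eq_bigr => h _.
  by rewrite mulr_sumr.
move=> l1 [i1 [j1 [i1m mj1]]]; rewrite G_scale//.
apply/negP; rewrite -ltNge; apply: (le_lt_trans (zr' l1 _ _ i1m mj1)).
by rewrite ltr_pMl ?G_gt0// invf_gt1.
Qed.

Lemma sum_update (r' : 'I_k -> 'I_q -> R) h0 l0 :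
  (forall h l, (h, l) != (h0, l0) -> r' h l = r h l) ->
  \sum_h \sum_l r' h l = 1 + (r' h0 l0 - r h0 l0).
Proof.
move=> E; rewrite -r_sum (bigD1 h0)//= [in RHS](bigD1 h0)//=.
rewrite (bigD1 l0)//= [in RHS](bigD1 l0)//=.
rewrite [X in _ + X + _ = _](eq_bigr (fun l => r h0 l)); last first.
  by move=> l ll0; apply: E; rewrite xpair_eqE negb_and ll0 orbT.
rewrite [X in _ + X = _](eq_bigr (fun h => \sum_l r h l)); last first.
  move=> h hh0; apply: eq_bigr => l _; apply: E.
  by rewrite xpair_eqE negb_and hh0.
ring.
Qed.

(** Otherwise the ratio of rank [x] in context [l] could be multiplied by some [c < 1] with every
    [G] staying at least [z], against [budget_ge1]. *)
Lemma tight_pair l (x : 'I_k) : exists i j : 'I_k,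
  [/\ (i < m)%N, (m <= j)%N, (i == x) || (j == x) &
      G y sigma rk r i j l = z].
Proof.
have [[i [j ?]]|none] := pselect (exists i j : 'I_k,
  [/\ (i < m)%N, (m <= j)%N, (i == x) || (j == x) &
      G y sigma rk r i j l = z]); first by exists i, j.
exfalso.
have zlt (i j : 'I_k) : (i < m)%N -> (m <= j)%N -> (i == x) || (j == x) ->
    z < G y sigma rk r i j l.
  move=> im mj ijx; rewrite lt_neqAle z_le// andbT; apply/eqP => zG.
  by apply: none; exists i, j.
(* The largest ratio [z / G] over pairs containing [x], hence below 1; the floor [2^-1] keeps it
   positive. *)
pose c := \big[Num.max/2^-1]_(p : 'I_k * 'I_k |
  [&& (p.1 < m)%N, (m <= p.2)%N & (p.1 == x) || (p.2 == x)])
  (z / G y sigma rk r p.1 p.2 l).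
have c1 : c < 1.
  apply: bigmax_lt; first by rewrite invf_lt1 ?ltr1n.
  move=> [i j] /= /and3P[im mj ijx].
  by rewrite ltr_pdivrMr ?mul1r ?zlt// G_gt0.
have c0 : 0 < c.
  by apply: (@lt_le_trans _ _ 2^-1); [rewrite invr_gt0|exact: bigmax_ge_id].
have cG (i j : 'I_k) : (i < m)%N -> (m <= j)%N -> (i == x) || (j == x) ->
    z <= c * G y sigma rk r i j l.
  move=> im mj ijx; rewrite -ler_pdivrMr ?G_gt0//.
  by apply: (@bigmax_sup _ _ _ _ (i, j)) => //=; rewrite im mj ijx.
pose r' h l' := if (h, l') == (rk l x, l) then c * r h l' else r h l'.
have r'0 h l' : 0 < r' h l' by rewrite /r'; case: ifP => _; rewrite ?mulr_gt0.
have : 1 <= \sum_h \sum_l r' h l.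
  apply: budget_ge1 => // l1 i j im mj.
  have [ll1|ll1] := eqVneq l1 l; last first.
    by rewrite /G /r' !xpair_eqE (negbTE ll1) !andbF; exact: z_le.
  rewrite {}ll1; have [ijx|ijx] := boolP ((i == x) || (j == x)); last first.
    move: ijx; rewrite negb_or => /andP[ix jx].
    rewrite /G /r' !xpair_eqE !(inj_eq perm_inj) (negbTE ix) (negbTE jx)/=.
    exact: z_le.
  (* [G] increases with the ratios, so shrinking one of them costs no more than shrinking all of
     them by [c]. *)
  apply: le_trans (cG _ _ im mj ijx) _; rewrite -G_scale//.
  have cle h l' : c * r h l' <= r' h l'.
    by rewrite /r'; case: ifP => // _; rewrite ler_piMl// ltW.
  rewrite /G; apply: ler_wpM2l; first exact: sqr_ge0.
  have cr0 h l' : 0 < c * r h l' by rewrite mulr_gt0.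
  rewrite lef_pV2 ?posrE ?addr_gt0 ?divr_gt0 ?exprn_gt0//.
  by rewrite lerD// ler_wpM2l ?sqr_ge0// lef_pV2 ?posrE.
rewrite (@sum_update _ (rk l x) l); last by move=> h l' /negbTE; rewrite /r' => ->.
rewrite /r' eqxx; have := r_gt0 (rk l x) l; nra.
Qed.

Lemma balance l :
  \sum_(i < k | (i < m)%N) r (rk l i) l ^+ 2 / sigma (rk l i) l ^+ 2
  = \sum_(j < k | (m <= j)%N) r (rk l j) l ^+ 2 / sigma (rk l j) l ^+ 2.
Proof.
pose s (x : 'I_k) : R := if (x < m)%N then 1 else -1.
pose w (x : 'I_k) : R := r (rk l x) l / sigma (rk l x) l ^+ 2.
pose a (x : 'I_k) : R := r (rk l x) l ^+ 2 / sigma (rk l x) l ^+ 2.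
suff : \sum_x s x * a x = 0.
  rewrite (bigID (fun x : 'I_k => (x < m)%N))/= => /eqP.
  rewrite addr_eq0 -sumrN => /eqP E.
  transitivity (\sum_(i < k | (i < m)%N) s i * a i).
    by apply: eq_bigr => i im; rewrite /s im mul1r.
  rewrite E; apply: eq_big => [j|j mj]; first by rewrite -leqNgt.
  by rewrite /s (negbTE mj) mulN1r opprK.
apply: (@stationary_sum_eq0 _ _ _ _ w).
- by move=> x; rewrite /s; case: ifP => _; rewrite ?sqrrN expr1n.
- by move=> x; rewrite divr_ge0// sqr_ge0.
- by move=> x; rewrite divr_ge0 ?sqr_ge0// ltW.
move=> t tw.
have den x : 0 < 1 - s x * t * w x.
  have := tw x; have [/= _] := (conj I (ler_norm (t * w x))).
  have := ler_norm (- (t * w x)); rewrite normrN normrM.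
  have w0 : 0 <= w x by rewrite divr_ge0 ?sqr_ge0// ltW.
  rewrite [`|w x|]ger0_norm// /s; case: ifP => _; lra.
have den' x : 0 < sigma (rk l x) l ^+ 2 - s x * t * r (rk l x) l.
  have sx0 : 0 < sigma (rk l x) l ^+ 2 by rewrite exprn_gt0.
  have -> : sigma (rk l x) l ^+ 2 - s x * t * r (rk l x) l
      = sigma (rk l x) l ^+ 2 * (1 - s x * t * w x).
    by rewrite /w; field; rewrite gt_eqF.
  by rewrite mulr_gt0.
(* Solves [sigma ^+ 2 / r' = sigma ^+ 2 / r - s x * t] in context [l], where [x] is the rank of [h].
   The shifts of a top and a non-top design cancel in [G]. *)
pose r' h l' := if l' == l
  then r h l / (1 - s ((rk l)^-1%g h) * t * w ((rk l)^-1%g h)) else r h l'.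
have r'0 h l' : 0 < r' h l' by rewrite /r'; case: ifP => // _; rewrite divr_gt0.
have r'E x : r' (rk l x) l = r (rk l x) l / (1 - s x * t * w x).
  by rewrite /r' eqxx permK.
have : 1 <= \sum_h \sum_l r' h l.
  apply: budget_ge1 => // l1 i j im mj.
  have [->|ll1] := eqVneq l1 l; last by rewrite /G /r' (negbTE ll1); exact: z_le.
  suff -> : G y sigma rk r' i j l = G y sigma rk r i j l by exact: z_le.
  have sE x : sigma (rk l x) l ^+ 2 / r' (rk l x) l
      = sigma (rk l x) l ^+ 2 / r (rk l x) l - s x * t.
    rewrite r'E /w; field.
    by rewrite !gt_eqF.
  rewrite /G !sE /s im ltnNge mj/=; congr (_ / _); ring.
(* Since [a x = r * w x], the change of budget at rank [x] is
   [t * (s x * a x / (1 - s x * t * w x))]. *)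
rewrite -subr_ge0 -[X in _ - X]r_sum -sumrB (reindex_inj (@perm_inj _ (rk l)))/=.
rewrite (eq_bigr (fun x => t * (s x * a x / (1 - s x * t * w x))))// => x _.
rewrite (bigD1 l)//= [in X in _ - X](bigD1 l)//= r'E.
rewrite (eq_bigr (fun l' => r (rk l x) l')) => [|l' /negbTE ll']; last first.
  by rewrite /r' ll'.
rewrite opprD addrACA subrr addr0 /a /w; field.
by rewrite !gt_eqF.
Qed.

End optimal_allocation.

(** * Minima over pairs and the optimality conditions *)

Lemma min_G_exists (R : realType) (k q m : nat) (y sigma : 'I_k -> 'I_q -> R)
    (rk : 'I_q -> {perm 'I_k}) (r : 'I_k -> 'I_q -> R) :
  (0 < m < k)%N -> 'I_q ->
  exists l, exists i j : 'I_k, [/\ (i < m)%N, (m <= j)%N &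
    forall l' (i' j' : 'I_k), (i' < m)%N -> (m <= j')%N ->
      G y sigma rk r i j l <= G y sigma rk r i' j' l'].
Proof.
move=> /andP[m0 mk] l0.
have P0 : ((l0, Ordinal (ltn_trans m0 mk), Ordinal mk).1.2 < m)%N &&
    (m <= (l0, Ordinal (ltn_trans m0 mk), Ordinal mk).2)%N by rewrite /= m0 leqnn.
have [[[l i] j] /= /andP[im mj] min] := @Order.TotalTheory.arg_minP _ _ _ _
  (fun p : 'I_q * 'I_k * 'I_k => (p.1.2 < m)%N && (m <= p.2)%N)
  (fun p => G y sigma rk r p.1.2 p.2 p.1.1) P0.
exists l, i, j; split => // l' i' j' i'm mj'.
by apply: (min (l', i', j')); rewrite /= i'm mj'.
Qed.

Lemma bigmine_eq (R : realType) (I : finType) (A : pred I) (F : I -> R) (z : R) :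
  (forall i, A i -> z <= F i) -> (exists2 i, A i & F i = z) ->
  \big[mine/+oo%E]_(i | A i) (F i)%:E = z%:E.
Proof.
move=> zF [i Ai Fi]; apply/eqP; rewrite eq_le; apply/andP; split.
  by rewrite -Fi; exact: bigmin_le_cond.
by apply: le_bigmin => [|j Aj]; rewrite ?leey// lee_fin zF.
Qed.

Theorem theorem2 (d : measure_display) (Omega : measurableType d)
  (R : realType) (P : probability Omega R) (k q m : nat)
  (Hmk : (1 <= m < k)%N)
  (y sigma : 'I_k -> 'I_q -> R)
  (rk : 'I_q -> {perm 'I_k})
  (Y : 'I_k -> 'I_q -> nat -> {RV P >-> R})
  (Hrank : ranked_by_mean m y rk)
  (Hsigma : forall h l, 0 < sigma h l)
  (Hnormal : forall h l t (A : set R), measurable A ->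
     distribution P (Y h l t) A = normal_prob (y h l) (sigma h l) A)
  (Hindep : mutually_independent P
     (fun a : 'I_k * 'I_q * nat => Y a.1.1 a.1.2 a.2 : Omega -> R))
  (H1 : assumption1 P Y)
  (H2 : assumption2 P Y)
  (H3 : assumption3 P Y y rk)
  (r : 'I_k -> 'I_q -> R)
  (Hopt : asymptotically_optimal P m Y rk r) :
  (forall (i j' : 'I_k) (l l' : 'I_q), (i < m)%N -> (m <= j')%N ->
     [/\ minG_over_j m y sigma rk r i l = minG_over_i m y sigma rk r j' l,
         minG_over_i m y sigma rk r j' l = minG_over_j m y sigma rk r i l' &
         minG_over_j m y sigma rk r i l' = minG_over_i m y sigma rk r j' l'])
  /\
  (forall l : 'I_q,
     \sum_(i < k | (i < m)%N) r (rk l i) l ^+ 2 / sigma (rk l i) l ^+ 2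
     = \sum_(j < k | (m <= j)%N) r (rk l j) l ^+ 2 / sigma (rk l j) l ^+ 2).
Proof.
have [[r_ge0 r_sum] opt] := Hopt.
have y_gap l (i j : 'I_k) : (i < m)%N -> (m <= j)%N ->
    y (rk l j) l < y (rk l i) l.
  have [/andP[m0 mk] [mono gap]] := (Hmk, Hrank l).
  (* The strict gap is given between the 0-based ranks [m.-1] and [m] only; monotonicity extends it
     to all pairs. *)
  have m1k : (m.-1 < k)%N by rewrite (leq_ltn_trans (leq_pred m)).
  move=> im mj; apply: (@le_lt_trans _ _ (y (rk l (Ordinal mk)) l)).
    exact: mono.
  apply: (@lt_le_trans _ _ (y (rk l (Ordinal m1k)) l)).
    by apply: gap => //=; rewrite prednK.
  by apply: mono => /=; rewrite -ltnS prednK.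
(* A total budget of 1 forces a context to exist. *)
have [h0 [l0 _]] : exists h l, r h l != 0.
  apply: contrapT => none; have : 0 = 1 :> R.
    rewrite -r_sum big1// => h _; apply: big1 => l _; apply/eqP.
    by apply: contrapT => /negP rhl; apply: none; exists h, l.
  by move/eqP; rewrite eq_sym oner_eq0.
have rate r' : (forall h l, 0 < r' h l) -> exists l, exists i j : 'I_k,
    [/\ (i < m)%N, (m <= j)%N,
     forall l' (i' j' : 'I_k), (i' < m)%N -> (m <= j')%N ->
      G y sigma rk r' i j l <= G y sigma rk r' i' j' l' &
     LD_rate P m Y rk r' = (G y sigma rk r' i j l / 2)%:E].
  move=> r'0; have [l [i [j [im mj min]]]] := min_G_exists y sigma rk r' Hmk l0.
  exists l, i, j; split => //.
  apply: (LD_rate_gt0 Hsigma Hnormal Hindep y_gap r'0); last by exists l, i, j.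
  by move=> l' i' j' i'm mj'; rewrite ler_pM2r ?min.
(* A zero ratio gives rate 0, whereas the uniform allocation has a positive rate. *)
have r_gt0 h l : 0 < r h l.
  rewrite lt_neqAle r_ge0 andbT eq_sym; apply/negP => /eqP rhl.
  pose S : R := k%:R * q%:R.
  have S0 : 0 < S.
    by rewrite mulr_gt0// ltr0n (leq_ltn_trans (leq0n _) (ltn_ord _)).
  have c0 : 0 < S^-1 by rewrite invr_gt0.
  have feas : feasible (fun (_ : 'I_k) (_ : 'I_q) => S^-1).
    split => [_ _|]; first exact: ltW.
    rewrite !sumr_const !card_ord -mulr_natr -[_ *+ q]mulr_natr -mulrA.
    by rewrite [_ * k%:R]mulrC mulVf ?gt_eqF.
  have [l1 [i [j [im mj _ LD]]]] := rate _ (fun _ _ => c0).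
  have r_eq0 : exists h l, r h l = 0 by exists h, l.
  have := opt _ feas; rewrite LD (LD_rate_eq0 rk Y Hmk r_eq0) lee_fin leNgt.
  by rewrite divr_gt0// (G_gt0 Hsigma y_gap).
have [l1 [i1 [j1 [i1m mj1 z_le LD]]]] := rate _ r_gt0.
set z := G y sigma rk r i1 j1 l1 in z_le LD.
have z_max r' : (forall h l, 0 < r' h l) -> \sum_h \sum_l r' h l = 1 ->
    exists l, exists i j : 'I_k,
    [/\ (i < m)%N, (m <= j)%N & G y sigma rk r' i j l <= z].
  move=> r'0 r'1; have [l [i [j [im mj _ LD']]]] := rate _ r'0.
  exists l, i, j; split => //.
  have := opt r' (conj (fun h l => ltW (r'0 h l)) r'1).
  by rewrite LD LD' lee_fin ler_pM2r.
have tight := tight_pair Hsigma y_gap r_gt0 r_sum z_le z_max.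
have minj (i : 'I_k) l : (i < m)%N -> minG_over_j m y sigma rk r i l = z%:E.
  move=> im; apply: bigmine_eq => [j mj|]; first exact: z_le.
  have [i' [j [i'm mj + zG]]] := tight l i.
  (* A top rank can only be the first component of its tight pair. *)
  case/orP => /eqP e; first by exists j; rewrite // -e.
  by move: mj; rewrite e leqNgt im.
have mini (j : 'I_k) l : (m <= j)%N -> minG_over_i m y sigma rk r j l = z%:E.
  move=> mj; apply: bigmine_eq => [i im|]; first exact: z_le.
  have [i [j' [im mj' + zG]]] := tight l j.
  case/orP => /eqP e; last by exists i; rewrite // -e.
  by move: im; rewrite e ltnNge mj.
split; first by move=> i j l l' im mj; rewrite !minj// !mini.
exact: (balance Hsigma y_gap r_gt0 r_sum z_le z_max).
Qed.
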